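(* Let $(\mathbf X^s,\mathbf U^s)$ be a stationary pair of stochastic processes, with $\varrho^s_X$ the law of $X^s(k)$. If the stochastic optimal control problem has the pathwise-in-probability turnpike property with respect to $(\mathbf X^s,\mathbf U^s)$, then it also has the weak distributional turnpike property with respect to $(\mathbf X^s,\mathbf U^s)$, i.e. the distributional turnpike property with $d_D$ the Lévy–Prokhorov metric.
   Context: Setting. $\mathcal X,\mathcal U,\mathcal W$ are separable Banach spaces, $\|\cdot\|$ is the norm of $\mathcal X$, $(\Omega,\mathcal F,\mathbb P)$ is a probability space, $n,l\ge 1$ are fixed exponents, and $L^n(\Omega,\mathcal F,\mathbb P;\mathcal X)$ is the space of $\mathcal X$-valued random variables with finite $n$-th moment. $f:\mathcal X\times\mathcal U\times\mathcal W\to\mathcal X$ is continuous in $(x,u)$ for almost all $w$. $\mathbf W=(W(0),W(1),\dots)$ is a fixed i.i.d. sequence with distribution $\varrho_W$. The control system is $X(k+1)=f(X(k),U(k),W(k))$, $X(0)=X_0$, with $X(k)\in L^n(\Omega,\mathcal F_k,\mathbb P;\mathcal X)$, $U(k)\in L^l(\Omega,\mathcal F_k,\mathbb P;\mathcal U)$, $\mathcal F_k=\sigma(X(0),\dots,X(k))$; it is always required that $W(k)$ is independent of $(X(k),U(k))$. The trajectory is denoted $X_{\mathbf U}(k,X_0)$ or $X(k)$. The constraint set $\mathbb Y\subseteq L^n(\Omega,\mathcal F,\mathbb P;\mathcal X)\times L^l(\Omega,\mathcal F,\mathbb P;\mathcal U)$ is law-invariant (if $(X,U)\in\mathbb Y$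 and $(Y,V)$ has the same joint law as $(X,U)$, then $(Y,V)\in\mathbb Y$); $\mathbb X:=\{X : \exists U,\ (X,U)\in\mathbb Y\}$. $\mathbb U^N(X_0)$ is the set of admissible control sequences $\mathbf U=(U(0),\dots,U(N-1))$ for $X_0\in\mathbb X$: $U(k)\in L^l(\Omega,\mathcal F_k,\mathbb P;\mathcal U)$, $(X(k),U(k))\in\mathbb Y$ for $k=0,\dots,N-1$, and $X(N)\in\mathbb X$; $\mathbb U^\infty(X_0)$ is defined analogously for infinite sequences ($(X(k),U(k))\in\mathbb Y$ for all $k\in\mathbb N_0$). It is assumed that $\mathbb U^\infty(X_0)\ne\emptyset$ for all $X_0\in\mathbb X$. The stage cost $\ell:\mathbb Y\to\mathbb R$ is law-invariant ($\ell(X,U)$ depends only on the joint law of $(X,U)$). Markov policies. $\Pi_0(\mathcal X,\mathcal U)$ is the set of (measurable) maps $\pi:\mathcal X\to\mathcal U$ with $\pi\circ X\in L^l(\Omega,\mathcal F,\mathbb P;\mathcal U)$ for all $X\in L^n(\Omega,\mathcal F,\mathbb P;\mathcal X)$. $\mathbb F^N(X_0)$ (for $N\in\mathbb N\cup\{\infty\}$) is the set of $\mathbf U\in\mathbb U^N(X_0)$ such that for every $k<N$ there is $\pi_k\in\Pi_0(\mathcal X,\mathcal U)$ with $U(k)=\pi_k(X(k))$. The stochastic optimal control problem is to minimize $J_N(X_0,\mathbf U)=\sum_{k=0}^{N-1}\ell(X(k),U(k))$ over $\mathbf U\in\mathbb F^N(X_0)$. Stationary pair. $(\mathbf X^s,\mathbf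 U^s)$ with $X^s(k+1)=f(X^s(k),U^s(k),W(k))$ (same noise $\mathbf W$), $\mathbf U^s\in\mathbb F^\infty(X^s(0))$, is stationary if the laws of $X^s(k)$, of $U^s(k)$ and of $(X^s(k),U^s(k))$ do not depend on $k\in\mathbb N_0$. Then $\ell(\mathbf X^s,\mathbf U^s)$ denotes the $k$-independent value $\ell(X^s(k),U^s(k))$. $\mathcal K_\infty$ is the set of continuous, strictly increasing, unbounded $\alpha:[0,\infty)\to[0,\infty)$ with $\alpha(0)=0$. $P_X$ denotes the law of $X$; $\mathcal P_n(\mathcal X)$ is the set of Borel probability measures on $\mathcal X$ with finite $n$-th moment. Pathwise-in-probability turnpike property: there exists $\alpha_2\in\mathcal K_\infty$ such that for each $X_0\in\mathbb X$ there is $C_b>0$ such that for each $\delta>0$, $N\in\mathbb N$, each $\mathbf U\in\mathbb F^N(X_0)$ with $J_N(X_0,\mathbf U)\le\delta+N\ell(\mathbf X^s,\mathbf U^s)$ and each $\varepsilon>0$, $$\#\{k\in\{0,\dots,N\} : \mathbb P(\|X_{\mathbf U}(k,X_0)-X^s(k)\|\le\varepsilon)\ge 1-\varepsilon\}\ \ge\ N-\frac{\delta+C_b}{\alpha_2(\varepsilon)}.$$ Distributional turnpike property with respect to a metric $d_D$ on $\mathcal P_n(\mathcal X)$: there exists $\alpha_3\in\mathcal K_\infty$ such that for each $X_0\in\mathbb X$ there is $C_c>0$ such that for each $\delta>0$, $N\in\mathbb N$, each $\mathbf U\in\mathbb F^N(X_0)$ with $J_N(X_0,\mathbf U)\le\delta+N\ell(\mathbf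 X^s,\mathbf U^s)$ and each $\varepsilon>0$, $$\#\{k\in\{0,\dots,N\} : d_D(P_{X_{\mathbf U}(k,X_0)},\varrho^s_X)\le\varepsilon\}\ \ge\ N-\frac{\delta+C_c}{\alpha_3(\varepsilon)}.$$ Lévy–Prokhorov metric: $d_{LP}(P_X,P_Y)=\inf\{d_{KF}(\bar X,\bar Y):\bar X\sim P_X,\ \bar Y\sim P_Y\}$ (infimum over all couplings), where $d_{KF}(X,Y)=\inf\{\varepsilon>0:\mathbb P(\|X-Y\|>\varepsilon)\le\varepsilon\}$ is the Ky Fan metric. *)

(* Defs.v *)
From HB Require Import structures.
From mathcomp Require Import all_boot all_order all_algebra finmap.
From mathcomp Require Import all_classical all_reals all_analysis.

Set Implicit Arguments.
Unset Strict Implicit.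
Unset Printing Implicit Defensive.

Import Order.TTheory GRing.Theory Num.Theory.
Import numFieldNormedType.Exports.

Local Open Scope classical_set_scope.
Local Open Scope ring_scope.

Definition separable (T : topologicalType) : Prop :=
  exists2 D : set T, countable D & dense D.

Notation borel V := (g_sigma_algebraType (@open V)).

(* [0, +oo) -> [0, +oo) maps are encoded as maps R -> R, of which only the
   values on [0, +oo) matter. *)
Definition Kinfty (R : realType) (a : R -> R) : Prop :=
  [/\ forall x, 0 <= x -> 0 <= a x,
      {within `[0, +oo[, continuous a},
      {in `[0, +oo[ &, {homo a : x y / x < y}},
      a 0 = 0
    & forall M : R, exists2 x, 0 <= x & M < a x].

Section random_variables.
Context {R : realType} {d : measure_display} {Omega : measurableType d}.
Variable P : probability Omega R.

(* Laws are compared on measurable sets only: the value of a measure on a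
   non-measurable set is unspecified. *)
Definition same_law d' (T : measurableType d') (X Y : Omega -> T) : Prop :=
  forall A, measurable A -> pushforward P X A = pushforward P Y A.

(* For a pair (X, U) the joint law lives on the product sigma-algebra, which
   is the Borel sigma-algebra of the product when the spaces are separable. *)
Definition pairing (T1 T2 : Type) (X : Omega -> T1) (U : Omega -> T2)
  : Omega -> T1 * T2 := fun w => (X w, U w).

Definition independent (G H : set_system Omega) : Prop :=
  forall A B, G A -> H B -> P (A `&` B) = (P A * P B)%E.

Definition independent_rv d1 d2 (T1 : measurableType d1)
    (T2 : measurableType d2) (X : Omega -> T1) (Y : Omega -> T2) : Prop :=
  independent (g_sigma_algebra_preimage X) (g_sigma_algebra_preimage Y).

Definition mutually_independent d' (T : measurableType d')
    (X : nat -> Omega -> T) : Prop :=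
  forall (I : {fset nat}) (A : nat -> set T), (forall i, measurable (A i)) ->
  P (\bigcap_(i in [set` I]) X i @^-1` A i) =
  (\prod_(i <- I) P (X i @^-1` A i))%E.

Definition sigma_family d' (T : measurableType d') (X : nat -> Omega -> T)
    (D : set nat) : set_system Omega :=
  <<s \bigcup_(k in D) g_sigma_algebra_preimage (X k) >>.

Definition natural_filtration d' (T : measurableType d')
    (X : nat -> Omega -> T) (k : nat) : set_system Omega :=
  sigma_family X [set i | (i <= k)%N].

Definition iid d' (T : measurableType d') (X : nat -> {RV P >-> T})
    (rho : probability T R) : Prop :=
  mutually_independent (fun k => X k : Omega -> T) /\
  forall k A, measurable A -> distribution P (X k) A = rho A.

Definition finite_moment (V : normedModType R) (p : R) (X : Omega -> V)
  : Prop := (\int[P]_w (`|X w| `^ p)%:E < +oo)%E.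

Definition Lrv (V : completeNormedModType R) (p : R)
  : set {RV P >-> borel V} := [set X | finite_moment p (X : Omega -> V)].

Definition Lrv_sub (V : completeNormedModType R) (G : set_system Omega)
    (p : R) : set {RV P >-> borel V} :=
  [set X | Lrv p X /\ g_sigma_algebra_preimage X `<=` G].

Definition ky_fan (V : normedModType R) (X Y : Omega -> V) : R :=
  inf [set e : R | 0 < e /\ (P [set w | (e < `|X w - Y w|)%R] <= e%:E)%E].

End random_variables.

(* The infimum ranges over all couplings, on all probability spaces. *)
Definition levy_prokhorov (R : realType) (V : completeNormedModType R)
    (mu nu : probability (borel V) R) : R :=
  inf [set r : R | exists (d : measure_display) (T : measurableType d)
    (Q : probability T R) (X Y : {RV Q >-> borel V}),
    [/\ forall A, measurable A -> distribution Q X A = mu A,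
        forall A, measurable A -> distribution Q Y A = nu A
      & r = ky_fan Q (X : T -> V) (Y : T -> V)]].

Section stochastic_control.
Context {R : realType} {X U W : completeNormedModType R}
  {d : measure_display} {Omega : measurableType d}.
Variables (P : probability Omega R) (n l : R) (f : X -> U -> W -> X)
  (noise : nat -> {RV P >-> borel W})
  (Y : set ({RV P >-> borel X} * {RV P >-> borel U}))
  (ell : {RV P >-> borel X} -> {RV P >-> borel U} -> R).

Definition law_invariant_set : Prop :=
  forall (X1 X2 : {RV P >-> borel X}) (U1 U2 : {RV P >-> borel U}),
  Y (X1, U1) ->
  same_law P (pairing X1 U1) (pairing X2 U2) -> Y (X2, U2).

(* The stage cost is a function on Y; its values outside Y are junk. *)
Definition law_invariant_cost : Prop :=
  forall (X1 X2 : {RV P >-> borel X}) (U1 U2 : {RV P >-> borel U}),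
  Y (X1, U1) -> Y (X2, U2) ->
  same_law P (pairing X1 U1) (pairing X2 U2) -> ell X1 U1 = ell X2 U2.

Definition state_constraint : set {RV P >-> borel X} :=
  [set Xi | exists Ui, Y (Xi, Ui)].

(* A horizon is [Some N], or [None] for the infinite horizon. *)
Definition before (k : nat) (N : option nat) : bool :=
  if N is Some m then (k < m)%N else true.

(* Finite control sequences and trajectories are initial segments of infinite
   sequences: only U k for k < N and x k for k <= N are constrained. *)
Definition trajectory (N : option nat) (X0 : {RV P >-> borel X})
    (u : nat -> {RV P >-> borel U}) (x : nat -> {RV P >-> borel X}) : Prop :=
  x 0%N = X0 /\
  forall k, before k N -> forall w, x k.+1 w = f (x k w) (u k w) (noise k w).

(* [admissible N X0 u x]: u is an admissible control sequence of horizon N for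
   X0, and x, which u and X0 determine up to time N, is its trajectory.  That
   x k is in L^n follows from Y being a subset of L^n * L^l. *)
Definition admissible (N : option nat) (X0 : {RV P >-> borel X})
    (u : nat -> {RV P >-> borel U}) (x : nat -> {RV P >-> borel X}) : Prop :=
  [/\ trajectory N X0 u x,
      forall k, before k N ->
        Lrv_sub (natural_filtration (fun i => x i : Omega -> borel X) k) l
          (u k),
      forall k, before k N -> independent_rv P (noise k) (pairing (x k) (u k)),
      forall k, before k N -> Y (x k, u k)
    & if N is Some m then state_constraint (x m) else True].

(* Admissibility requires the noise to be independent of the state, so no
   control is admissible for an X0 that depends on noise 0, while a
   law-invariant Y in general allows such X0.  Nonemptiness can therefore only
   be asked of initial values independent of the noise. *)
Definition infinite_horizon_feasible : Prop :=
  forall X0, state_constraint X0 ->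
  independent P (g_sigma_algebra_preimage X0)
    (sigma_family (fun k => noise k : Omega -> borel W) setT) ->
  exists u x, admissible None X0 u x.

Definition policy (pi : {mfun borel X >-> borel U}) : Prop :=
  forall Xi : {RV P >-> borel X}, Lrv n Xi ->
  finite_moment P l (fun w => pi (Xi w) : U).

Definition markov_admissible (N : option nat) (X0 : {RV P >-> borel X})
    (u : nat -> {RV P >-> borel U}) (x : nat -> {RV P >-> borel X}) : Prop :=
  admissible N X0 u x /\
  forall k, before k N ->
  exists2 pi, policy pi & forall w, u k w = pi (x k w).

Definition cost (N : nat) (u : nat -> {RV P >-> borel U})
    (x : nat -> {RV P >-> borel X}) : R := \sum_(k < N) ell (x k) (u k).

Definition stationary_pair (xs : nat -> {RV P >-> borel X})
    (us : nat -> {RV P >-> borel U}) : Prop :=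
  [/\ markov_admissible None (xs 0%N) us xs,
      forall k, same_law P (xs k) (xs 0%N),
      forall k, same_law P (us k) (us 0%N)
    & forall k, same_law P (pairing (xs k) (us k))
                           (pairing (xs 0%N) (us 0%N))].

(* For a stationary pair ell (xs k) (us k) and the law of xs k do not depend
   on k; both are read off at k = 0. *)
Definition stationary_cost (xs : nat -> {RV P >-> borel X})
    (us : nat -> {RV P >-> borel U}) : R := ell (xs 0%N) (us 0%N).

Definition stationary_law (xs : nat -> {RV P >-> borel X})
  : probability (borel X) R := distribution P (xs 0%N).

Definition pathwise_in_probability_turnpike
    (xs : nat -> {RV P >-> borel X}) (us : nat -> {RV P >-> borel U}) : Prop :=
  exists2 alpha : R -> R, Kinfty alpha &
  forall X0, state_constraint X0 ->
  exists2 C : R, 0 < C &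
  forall (delta : R) (N : nat) u x, 0 < delta -> (0 < N)%N ->
  markov_admissible (Some N) X0 u x ->
  cost N u x <= delta + N%:R * stationary_cost xs us ->
  forall eps : R, 0 < eps ->
  N%:R - (delta + C) / alpha eps <=
  #|[pred k : 'I_N.+1 |
      ((1 - eps)%:E <=
       P [set w | (`|(x k w : X) - (xs k w : X)| <= eps)%R])%E]|%:R.

Definition distributional_turnpike
    (dist : probability (borel X) R -> probability (borel X) R -> R)
    (xs : nat -> {RV P >-> borel X}) (us : nat -> {RV P >-> borel U}) : Prop :=
  exists2 alpha : R -> R, Kinfty alpha &
  forall X0, state_constraint X0 ->
  exists2 C : R, 0 < C &
  forall (delta : R) (N : nat) u x, 0 < delta -> (0 < N)%N ->
  markov_admissible (Some N) X0 u x ->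
  cost N u x <= delta + N%:R * stationary_cost xs us ->
  forall eps : R, 0 < eps ->
  N%:R - (delta + C) / alpha eps <=
  #|[pred k : 'I_N.+1 |
      dist (distribution P (x k)) (stationary_law xs) <= eps]|%:R.

Definition weak_distributional_turnpike :=
  distributional_turnpike (@levy_prokhorov R X).

End stochastic_control.

(* Main.v *)
Require Import Defs.
From HB Require Import structures.
From mathcomp Require Import all_boot all_order all_algebra finmap.
From mathcomp Require Import all_classical all_reals all_analysis.
From mathcomp Require Import lra.

Import Order.TTheory GRing.Theory Num.Theory.
Import numFieldNormedType.Exports.

Local Open Scope classical_set_scope.
Local Open Scope ring_scope.

(** At every time k, the pair consisting of the state and the stationary state
    is itself a coupling of its two marginal laws, and the law of the
    stationary state does not depend on k.  The infimum over all couplings that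
    defines the Levy-Prokhorov distance is therefore at most the Ky Fan
    distance of that pair ([levy_prokhorov_le_ky_fan]).  The event by which the
    pathwise property counts k, a deviation at most eps with probability at
    least 1 - eps, says by passing to the complement that eps is one of the
    values in the infimum that defines the Ky Fan distance
    ([ky_fan_le_of_probability]).  So every time counted by the pathwise
    property is counted by the distributional one, with the same comparison
    function and the same constants.

    The one delicate point is the passage to the complement, which requires the
    deviation event to be measurable.  The norm of a difference is Borel on the
    Borel sigma-algebra of the product space, but two random variables are only
    jointly measurable for the product of the Borel sigma-algebras; the two
    agree when the space is separable ([measurable_dist_gt]). *)

(** By separability, |X - Y| > e holds exactly when some point a of a countable
    dense set and some rational q satisfy |a - X| < q and e + q < |a - Y|.  This
    writes the event as a countable union of intersections of an event of X
    with an event of Y. *)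
Lemma measurable_dist_gt (R : realType) (V : completeNormedModType R)
    (d : measure_display) (T : measurableType d) (X Y : T -> borel V) (e : R) :
  separable V -> measurable_fun setT X -> measurable_fun setT Y ->
  measurable [set w | e < `|(X w : V) - (Y w : V)|].
Proof.
move=> [D cD dD] mX mY.
have mopen (Z : T -> borel V) (A : set V) :
    measurable_fun setT Z -> open A -> measurable (Z @^-1` A).
  move=> mZ oA; rewrite -[_ @^-1` _]setTI; apply: mZ => //.
  exact: sub_sigma_algebra.
pose B a q := (X @^-1` [set z : V | `|a - z| < ratr q]) `&`
              (Y @^-1` [set z : V | e + ratr q < `|a - z|]).
have cdist (a : V) : continuous (fun z : V => `|a - z|).
  move=> z; apply: (@cvg_comp _ _ _ (fun z : V => a - z)); last exact: norm_continuous.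
  by apply: cvgB; [exact: cvg_cst|exact: cvg_id].
have mB a q : measurable (B a q).
  apply: measurableI; apply: mopen => //.
    apply: (@open_comp _ _ (fun z : V => `|a - z|) [set r | r < ratr q]).
      by move=> z _; exact: cdist.
    exact: open_lt.
  apply: (@open_comp _ _ (fun z : V => `|a - z|) [set r | e + ratr q < r]).
    by move=> z _; exact: cdist.
  exact: open_gt.
have -> : [set w | e < `|(X w : V) - (Y w : V)|] =
    \bigcup_(a in D) \bigcup_q B a q.
  apply/seteqP; split=> [w /= ew|w [a _ [q _ [/= aX aY]]]]; last first.
    have : `|a - Y w| <= `|a - X w| + `|(X w : V) - Y w|.
      by have := ler_normD (a - X w : V) (X w - Y w : V); rewrite addrA subrK.
    lra.
  (* Half of the excess bounds the distance from a to X w. *)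
  pose r := (`|(X w : V) - Y w| - e) / 2.
  have r0 : 0 < r by rewrite /r; lra.
  have [a [Da /= aXr]] : D `&` ball (X w : V) r !=set0.
    rewrite setIC; apply: dD; last exact: ball_open.
    by exists (X w); exact: ballxx.
  rewrite -ball_normE /= distrC in aXr.
  have [q] := rat_in_itvoo aXr; rewrite in_itv /= => /andP[aq qr].
  exists a => //; exists q => //; split => //=.
  have : `|(X w : V) - Y w| <= `|a - X w| + `|a - Y w|.
    have := ler_normD (X w - a : V) (a - Y w : V).
    by rewrite addrA subrK (distrC (X w : V) a).
  rewrite /r in qr; lra.
have [->|[g]] := pfcard_geP cD; first by rewrite bigcup0.
have -> : \bigcup_(a in D) \bigcup_q B a q = \bigcup_i \bigcup_q B (g i) q.
  apply/seteqP; split=> [w [a /(@surj _ _ _ _ g)[i _ <-] Bw]|w [i _ Bw]].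
    by exists i.
  by exists (g i) => //; exact: funS.
apply: bigcupT_measurable => i; exact: bigcupT_measurable_rat.
Qed.

Lemma ky_fan_ge0 (R : realType) (d : measure_display) (T : measurableType d)
    (Q : probability T R) (V : normedModType R) (X Y : T -> V) :
  0 <= ky_fan Q X Y.
Proof.
rewrite /ky_fan; set E := [set e | _].
(* The infimum of an empty set is 0 by convention. *)
have [->|E0] := eqVneq E set0; first by rewrite inf0.
by apply: lb_le_inf; [exact/set0P|move=> e [/ltW]].
Qed.

Lemma ky_fan_le_of_probability (R : realType) (V : completeNormedModType R)
    (d : measure_display) (T : measurableType d) (Q : probability T R)
    (X Y : {RV Q >-> borel V}) (e : R) :
  separable V -> 0 < e ->
  ((1 - e)%:E <= Q [set w | (`|(X w : V) - (Y w : V)| <= e)%R])%E ->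
  ky_fan Q (X : T -> V) (Y : T -> V) <= e.
Proof.
move=> sepV e0 Qe; apply: ge_inf; first by exists 0 => r [/ltW].
split => //; set A := [set w | _].
have mA : measurable A by exact: measurable_dist_gt.
have AC : [set w | `|(X w : V) - (Y w : V)| <= e] = ~` A.
  by apply/seteqP; split=> w /=; rewrite leNgt => /negP.
move: Qe; rewrite AC probability_setC// -[Q A]fineK ?fin_num_measure//.
rewrite -EFinB !lee_fin; lra.
Qed.

Lemma levy_prokhorov_le_ky_fan (R : realType) (V : completeNormedModType R)
    (d : measure_display) (T : measurableType d) (Q : probability T R)
    (X Y : {RV Q >-> borel V}) (mu nu : probability (borel V) R) :
  (forall A, measurable A -> distribution Q X A = mu A) ->
  (forall A, measurable A -> distribution Q Y A = nu A) ->
  levy_prokhorov mu nu <= ky_fan Q (X : T -> V) (Y : T -> V).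
Proof.
move=> Xmu Ynu; apply: ge_inf; last by exists d, T, Q, X, Y.
by exists 0 => _ [d' [T' [Q' [X' [Y' [_ _ ->]]]]]]; exact: ky_fan_ge0.
Qed.

Theorem mainTheorem3 (R : realType) (X U W : completeNormedModType R)
  (sepX : separable X) (sepU : separable U) (sepW : separable W)
  (d : measure_display) (Omega : measurableType d) (P : probability Omega R)
  (n l : R) (n_ge1 : 1 <= n) (l_ge1 : 1 <= l)
  (f : X -> U -> W -> X) (rhoW : probability (borel W) R)
  (f_cont : {ae rhoW, forall w : borel W,
     continuous (fun z : X * U => f z.1 z.2 w)})
  (noise : nat -> {RV P >-> borel W}) (noise_iid : iid noise rhoW)
  (Y : set ({RV P >-> borel X} * {RV P >-> borel U}))
  (Y_sub : forall Xi Ui, Y (Xi, Ui) -> Lrv n Xi /\ Lrv l Ui)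
  (Y_law : law_invariant_set Y)
  (Y_feasible : infinite_horizon_feasible l f noise Y)
  (ell : {RV P >-> borel X} -> {RV P >-> borel U} -> R)
  (ell_law : law_invariant_cost Y ell)
  (xs : nat -> {RV P >-> borel X}) (us : nat -> {RV P >-> borel U})
  (xs_us_stationary : stationary_pair n l f noise Y xs us) :
  pathwise_in_probability_turnpike n l f noise Y ell xs us ->
  weak_distributional_turnpike n l f noise Y ell xs us.
Proof.
move=> [alpha Kalpha pathwise]; exists alpha => // X0 X0Y.
have [C C0 count] := pathwise X0 X0Y; exists C => //.
move=> delta N u x delta0 N0 ux costN eps eps0.
apply: le_trans (count delta N u x delta0 N0 ux costN eps eps0) _.
rewrite ler_nat; apply: subset_leq_card; apply/fintype.subsetP => k.
rewrite !inE => close.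
have [_ xs_law _ _] := xs_us_stationary.
apply: le_trans (ky_fan_le_of_probability _ _ _ _ _ _ _ _ sepX eps0 close).
by apply: levy_prokhorov_le_ky_fan => // A; exact: xs_law.
Qed.
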